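(* Let $\mathbb{K}$ be an algebraically closed field of characteristic $0$. For any Lie algebra $\mathfrak{g}$ over $\mathbb{K}$ there is an exact sequence $$0\longrightarrow \operatorname{H}^2(\mathfrak{g},\mathbb{K})\stackrel{f}{\longrightarrow}\operatorname{HL}^2(\mathfrak{g},\mathbb{K})\stackrel{g}{\longrightarrow}\operatorname{B}(\mathfrak{g},\mathbb{K})\stackrel{h}{\longrightarrow}\operatorname{H}^3(\mathfrak{g},\mathbb{K}),$$ where $f$ is the natural embedding (sending the class of a Lie $2$-cocycle to its class as a Leibniz $2$-cocycle), $g$ is defined by $g(\alpha)(x,y)=\alpha(x,y)+\alpha(y,x)$ for $\alpha\in\operatorname{HL}^2(\mathfrak{g},\mathbb{K})$ and $x,y\in\mathfrak{g}$, and $h$ is the Cartan--Koszul map, which sends $\alpha\in\operatorname{B}(\mathfrak{g},\mathbb{K})$ to the class of $h(\alpha)(x,y,z)=\alpha([x,y],z)$, $x,y,z\in\mathfrak{g}$.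
   Context: $\operatorname{H}^*(\mathfrak{g},\mathbb{K})$ is Chevalley--Eilenberg cohomology with trivial coefficients, computed from $\Omega^n(\mathfrak{g},\mathbb{K})=\operatorname{Hom}(\wedge^n\mathfrak{g},\mathbb{K})$ with $(\delta^n f)(x_1,\dots,x_{n+1})=\sum_{i<j}(-1)^{i+j}f([x_i,x_j],x_1,\dots,\hat{x}_i,\dots,\hat{x}_j,\dots,x_{n+1})$. $\operatorname{HL}^*(\mathfrak{g},\mathbb{K})$ is Leibniz cohomology with trivial coefficients, computed from $C^n(\mathfrak{g},\mathbb{K})=\operatorname{Hom}_{\mathbb{K}}(\mathfrak{g}^{\otimes n},\mathbb{K})$ with the Loday coboundary $(d^n f)(x_1,\dots,x_{n+1})=\sum_{1\le i<j\le n+1}(-1)^{j+1}f(x_1,\dots,x_{i-1},[x_i,x_j],x_{i+1},\dots,\hat{x}_j,\dots,x_{n+1})$. Thus a Leibniz $2$-cocycle is a bilinear form $\alpha$ on $\mathfrak{g}$ with $\alpha(x,[y,z])=\alpha([x,y],z)-\alpha([x,z],y)$, and $2$-coboundaries are $(x,y)\mapsto-\beta([x,y])$ with $\beta\in\mathfrak{g}^*$. $\operatorname{B}(\mathfrak{g},\mathbb{K})$ is the space of all $\mathbb{K}$-valued symmetric bilinear forms $\phi$ on $\mathfrak{g}$ that are invariant: $\phi([x,y],z)=\phi(x,[y,z])$ for all $x,y,z\in\mathfrak{g}$. *)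

(* Defs.v *)
From HB Require Import structures.
From mathcomp Require Import all_boot all_order all_algebra.
From mathcomp Require Import generic_quotient ring_quotient.
From mathcomp Require Import boolp functions.

Set Implicit Arguments.
Unset Strict Implicit.
Unset Printing Implicit Defensive.

Import GRing.Theory.
Local Open Scope ring_scope.
Local Open Scope quotient_scope.

HB.mixin Record Lmodule_isLie (K : pzRingType) g of GRing.Lmodule K g := {
  bracket : g -> g -> g;
  bracket_linearl : forall z, linear (bracket^~ z);
  bracket_linearr : forall x, linear (bracket x);
  bracketxx : forall x, bracket x x = 0;
  bracket_jacobi : forall x y z,
    bracket x (bracket y z) + bracket y (bracket z x)
      + bracket z (bracket x y) = 0 }.

#[short(type="lieAlgType")]
HB.structure Definition LieAlgebra (K : pzRingType) :=
  { g of GRing.Lmodule K g & Lmodule_isLie K g }.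

(* MathComp has subspaces only of finite-dimensional spaces and quotients only
   of Z-modules; the Lie algebras considered here have arbitrary dimension. *)
Section Submodule.
Variables (K : pzRingType) (V : lmodType K) (S : submodClosed V).

Record submod := Submod { submod_val : V; _ : submod_val \in S }.

HB.instance Definition _ := [isSub for submod_val].
HB.instance Definition _ := [Choice of submod by <:].
HB.instance Definition _ := [SubChoice_isSubLmodule of submod by <:].

End Submodule.

Section QuotientModule.
Variables (K : pzRingType) (V : lmodType K) (S : submodClosed V).

(* submodClosed does not inherit from zmodClosed *)
Definition submod_zmod : {pred V} := fun v => v \in S.

Lemma submod_zmod_closed : zmod_closed submod_zmod.
Proof. exact: GRing.submod_closedB (submodClosedP S). Qed.

HB.instance Definition _ := GRing.isZmodClosed.Build V submod_zmod
  submod_zmod_closed.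

Definition quotmod := Quotient.quot submod_zmod.

HB.instance Definition _ := GRing.Zmodule.on quotmod.
HB.instance Definition _ := EqQuotient.on quotmod.

Definition quotmod_scale (a : K) : quotmod -> quotmod :=
  lift_op1 quotmod ( *:%R a).

Lemma quotmod_eqE x y : (x == y %[mod quotmod]) = (x - y \in S).
Proof. by rewrite piE. Qed.

Lemma pi_quotmod_add : {morph \pi_quotmod : x y / x + y}.
Proof. exact: Quotient.pi_add. Qed.

Lemma pi_quotmod_scale a :
  {morph \pi_quotmod : x / a *: x >-> quotmod_scale a x}.
Proof.
move=> x; rewrite /quotmod_scale; unlock; apply/eqP.
by rewrite quotmod_eqE -scalerBr rpredZ // -quotmod_eqE reprK.
Qed.

Lemma quotmod_scaleA a b x :
  quotmod_scale a (quotmod_scale b x) = quotmod_scale (a * b) x.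
Proof. by elim/quotW: x => x; rewrite -!pi_quotmod_scale scalerA. Qed.

Lemma quotmod_scale1 : left_id 1 quotmod_scale.
Proof. by elim/quotW=> x; rewrite -pi_quotmod_scale scale1r. Qed.

Lemma quotmod_scaleDr : right_distributive quotmod_scale +%R.
Proof.
move=> a; elim/quotW=> x; elim/quotW=> y.
by rewrite -!(pi_quotmod_add, pi_quotmod_scale) scalerDr.
Qed.

Lemma quotmod_scaleDl x : {morph quotmod_scale^~ x : a b / a + b}.
Proof.
move=> a b /=; elim/quotW: x => x.
by rewrite -!(pi_quotmod_add, pi_quotmod_scale) scalerDl.
Qed.

HB.instance Definition _ := GRing.Zmodule_isLmodule.Build K quotmod
  quotmod_scaleA quotmod_scale1 quotmod_scaleDr quotmod_scaleDl.

Lemma pi_quotmod_linear : linear \pi_quotmod.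
Proof. by move=> a x y; rewrite pi_quotmod_add pi_quotmod_scale. Qed.

HB.instance Definition _ := GRing.isLinear.Build K V quotmod _ \pi_quotmod
  pi_quotmod_linear.

End QuotientModule.

Section Cochains.
Variables (K : comPzRingType) (g : lmodType K).

Definition cochain n : Type := n.-tuple g -> K^o.

HB.instance Definition _ n := GRing.Lmodule.on (cochain n).

Definition update n (t : n.-tuple g) (i : 'I_n) (u : g) : n.-tuple g :=
  [tuple if k == i then u else tnth t k | k < n].

Definition multilinear n (f : cochain n) : Prop :=
  forall (i : 'I_n) (t : n.-tuple g), linear (fun u => f (update t i u)).

Definition alternating n (f : cochain n) : Prop :=
  forall (t : n.-tuple g) (i j : 'I_n),
    i != j -> tnth t i = tnth t j -> f t = 0.

(* Hom(g^{(x) n}, K) *)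
Definition tensor_cochain n : {pred cochain n} := fun f => `[< multilinear f >].

(* Hom(/\^n g, K) *)
Definition exterior_cochain n : {pred cochain n} :=
  fun f => `[< multilinear f /\ alternating f >].

Lemma multilinear0 n : multilinear (0 : cochain n).
Proof. by move=> i t a u v; rewrite /= scaler0 addr0. Qed.

Lemma multilinearP n a (f f' : cochain n) :
  multilinear f -> multilinear f' -> multilinear (a *: f + f').
Proof.
move=> lf lf' i t b u v; rewrite /= !fctE [f _]lf [f' _]lf'.
by rewrite !scalerDr !scalerA [a * b]mulrC addrACA.
Qed.

Lemma tensor_cochain_closed n : submod_closed (@tensor_cochain n).
Proof.
split=> [|a f f' /asboolP lf /asboolP lf']; apply/asboolP.
  exact: multilinear0.
exact: multilinearP.
Qed.

HB.instance Definition _ n := GRing.isSubmodClosed.Build K (cochain n)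
  (@tensor_cochain n) (tensor_cochain_closed n).

Lemma exterior_cochain_closed n : submod_closed (@exterior_cochain n).
Proof.
split=> [|a f f' /asboolP[lf af] /asboolP[lf' af']]; apply/asboolP.
  by split=> //; apply: multilinear0.
split=> [|t i j ij tij]; first exact: multilinearP.
by rewrite !fctE (af t i j) // (af' t i j) // scaler0 addr0.
Qed.

HB.instance Definition _ n := GRing.isSubmodClosed.Build K (cochain n)
  (@exterior_cochain n) (exterior_cochain_closed n).

End Cochains.

(* The inclusion d (C n) <= C n.+1 and the equation d \o d = 0 are not needed
   to form the quotient of the cocycles by those cocycles that are of the form
   d b with b in C. *)
Record cochain_complex (K : comPzRingType) (g : lmodType K) := CochainComplex {
  cochains : forall n, submodClosed (cochain g n);
  cobound : forall n, {linear cochain g n -> cochain g n.+1} }.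

Section Cohomology.
Variables (K : comPzRingType) (g : lmodType K) (C : cochain_complex g).

Definition cocycle n : {pred cochain g n} :=
  fun f => (f \in cochains C n) && (cobound C n f == 0).

Lemma cocycle_closed n : submod_closed (@cocycle n).
Proof.
split=> [|a f f' /andP[Cf /eqP df] /andP[Cf' /eqP df']]; apply/andP; split.
- exact: rpred0.
- by rewrite linear0.
- by rewrite rpredD // rpredZ.
- by rewrite linearP df df' scaler0 addr0.
Qed.

HB.instance Definition _ n := GRing.isSubmodClosed.Build K (cochain g n)
  (@cocycle n) (cocycle_closed n).

Definition cocycles n := submod (@cocycle n).

HB.instance Definition _ n := SubChoice.on (cocycles n).
HB.instance Definition _ n := GRing.SubLmodule.on (cocycles n).

Definition coboundary n : {pred cocycles n} :=
  match n with
  | 0 => fun z => z == 0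
  | m.+1 => fun z =>
      `[< exists2 b, b \in cochains C m & \val z = cobound C m b >]
  end.

Lemma coboundary_closed n : submod_closed (@coboundary n).
Proof.
case: n => [|n]; split=> [|a z z'] /=.
- exact: eqxx.
- by move=> /eqP-> /eqP->; rewrite unfold_in scaler0 addr0.
- by apply/asboolP; exists 0; rewrite ?rpred0 // linear0.
- move=> /asboolP[b Cb zb] /asboolP[b' Cb' zb']; apply/asboolP.
  by exists (a *: b + b'); [rewrite rpredD // rpredZ | rewrite !linearP /= zb zb'].
Qed.

HB.instance Definition _ n := GRing.isSubmodClosed.Build K (cocycles n)
  (@coboundary n) (coboundary_closed n).

Definition cohomology n := quotmod (@coboundary n).

HB.instance Definition _ n := GRing.Lmodule.on (cohomology n).

Definition cohomology_class n : {linear cocycles n -> cohomology n} :=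
  \pi_(quotmod (@coboundary n)).

Lemma cohomology_class_surj n (x : cohomology n) :
  exists z, cohomology_class n z = x.
Proof. by exists (repr x); apply: reprK. Qed.

Lemma cohomology_class_eq n (z z' : cocycles n) :
  cohomology_class n z = cohomology_class n z' <-> z - z' \in @coboundary n.
Proof. by rewrite -quotmod_eqE; split=> /eqP. Qed.

End Cohomology.

Section Differentials.
Variables (K : comPzRingType) (g : lieAlgType K).

(* The list has size n whenever i != j, so the default 0 is then not used. *)
Definition ce_args n (t : n.+1.-tuple g) (i j : 'I_n.+1) : n.-tuple g :=
  [tuple nth 0 (bracket (tnth t i) (tnth t j)
                :: [seq tnth t k | k <- enum 'I_n.+1 & (k != i) && (k != j)]) m
   | m < n].

(* Indices start at 0, which does not change the parity of i + j. *)
Definition ce_diff n (f : cochain g n) : cochain g n.+1 := fun t =>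
  \sum_(i < n.+1) \sum_(j < n.+1 | (i < j)%N)
    (-1) ^+ (i + j) * f (ce_args t i j).

Lemma ce_diff_linear n : linear (@ce_diff n).
Proof.
move=> a f f'; apply/funext => t.
rewrite !fctE scaler_sumr -big_split /=; apply: eq_bigr => i _.
rewrite scaler_sumr -big_split /=; apply: eq_bigr => j _.
by rewrite mulrDr; congr (_ + _); apply: mulrCA.
Qed.

HB.instance Definition _ n := GRing.isLinear.Build K (cochain g n)
  (cochain g n.+1) _ (@ce_diff n) (@ce_diff_linear n).

(* The i-th entry is replaced by the bracket and the j-th entry removed. *)
Definition loday_args n (t : n.+1.-tuple g) (i j : 'I_n.+1) : n.-tuple g :=
  [tuple let k := lift j m in
         if k == i then bracket (tnth t i) (tnth t j) else tnth t k | m < n].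

(* The sign is (-1) ^ (j + 1) for indices starting at 1. *)
Definition loday_diff n (f : cochain g n) : cochain g n.+1 := fun t =>
  \sum_(i < n.+1) \sum_(j < n.+1 | (i < j)%N)
    (-1) ^+ j * f (loday_args t i j).

Lemma loday_diff_linear n : linear (@loday_diff n).
Proof.
move=> a f f'; apply/funext => t.
rewrite !fctE scaler_sumr -big_split /=; apply: eq_bigr => i _.
rewrite scaler_sumr -big_split /=; apply: eq_bigr => j _.
by rewrite mulrDr; congr (_ + _); apply: mulrCA.
Qed.

HB.instance Definition _ n := GRing.isLinear.Build K (cochain g n)
  (cochain g n.+1) _ (@loday_diff n) (@loday_diff_linear n).

End Differentials.

Definition chevalley_eilenberg (K : comPzRingType) (g : lieAlgType K) :=
  CochainComplex (fun n => @exterior_cochain K g n)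
    (fun n => @ce_diff K g n).

Definition loday (K : comPzRingType) (g : lieAlgType K) :=
  CochainComplex (fun n => @tensor_cochain K g n)
    (fun n => @loday_diff K g n).

Section InvariantForms.
Variables (K : comPzRingType) (g : lieAlgType K).

Definition invariant_form : {pred g -> g -> K^o} := fun phi =>
  `[< [/\ forall x, linear (phi x), forall y, linear (phi^~ y),
          forall x y, phi x y = phi y x
        & forall x y z, phi (bracket x y) z = phi x (bracket y z)] >].

Lemma invariant_form_closed : submod_closed invariant_form.
Proof.
split=> [|a p q /asboolP[lp rp sp ip] /asboolP[lq rq sq iq]]; apply/asboolP.
  by split=> // x b y z; rewrite /= scaler0 addr0.
split=> [x b y z|x b y z|x y|x y z]; rewrite /= !fctE.
- by rewrite lp lq !scalerDr !scalerA [a * b]mulrC addrACA.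
- by rewrite [p _ _]rp [q _ _]rq !scalerDr !scalerA [a * b]mulrC addrACA.
- by rewrite sp sq.
- by rewrite ip iq.
Qed.

HB.instance Definition _ := GRing.isSubmodClosed.Build K (g -> g -> K^o)
  invariant_form invariant_form_closed.

Definition invariant_forms := submod invariant_form.

HB.instance Definition _ := SubChoice.on invariant_forms.
HB.instance Definition _ := GRing.SubLmodule.on invariant_forms.

End InvariantForms.

Definition exact_at (U V W : zmodType) (f : U -> V) (h : V -> W) : Prop :=
  forall v, h v = 0 <-> exists u, f u = v.

(* Main.v *)
Require Import Defs.
From HB Require Import structures.
From mathcomp Require Import all_boot all_order all_algebra.
From mathcomp Require Import boolp functions.

(** The whole sequence comes from the Loday coboundary [d] of a single bilinear
form.  Two identities in degree 2 carry it:

- on an alternating form [w], [d w] is the Chevalley-Eilenberg coboundary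
  [delta w] ([loday_ce_diff2]);
- on an invariant symmetric form [phi], [d phi] is [- h phi], where
  [h phi (x, y, z) = phi ([x, y], z)] is the Cartan-Koszul cochain
  ([loday_diff_form_cochain]).

Every bilinear form [a] satisfies [2 a = phi + w], with
[phi (x, y) = a (x, y) + a (y, x)] symmetric and
[w (x, y) = a (x, y) - a (y, x)] alternating ([sym_skew_decomp]).  If
[phi] is invariant, then [2 d a = delta w - h phi], so, 2 being invertible, [a]
is a Leibniz cocycle if and only if [h phi = delta w].  This is exactness at
[B] ([cartan_koszul_exact]): from [h phi = delta w] one recovers the cocycle
[(phi + w) / 2], and conversely the symmetrization of a Leibniz cocycle is
always invariant ([sym_form_invariant]).

Exactness at [HL^2] is the case [phi = 0]: since 2 is invertible, a form with
zero symmetrization is alternating, so that a Leibniz cocycle of this kind is a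
Lie cocycle.  Injectivity of [f] holds because the two complexes coincide in
degree 1 and have there the same coboundary, hence have the same
2-coboundaries.

There remains to see that [h phi] is an alternating cocycle.  Invariance moves
brackets from one argument of [phi] to the other; this gives the alternation,
and turns the cocycle equation into the Jacobi identity
([ce_diff_cartan_koszul]). *)

Set Implicit Arguments.
Unset Strict Implicit.
Unset Printing Implicit Defensive.

Import GRing.Theory.
Local Open Scope ring_scope.

(** * Linear maps into submodules and out of cohomology *)

Lemma linear_zmod (R : pzRingType) (U V : lmodType R) (f : U -> V) :
  linear f ->
  [/\ f 0 = 0, {morph f : u / - u} & {morph f : u v / u + v}].
Proof.
move=> lf; have fD : {morph f : u v / u + v}.
  by move=> u v; have := lf 1 u v; rewrite !scale1r.
have f0 : f 0 = 0 by apply: (addrI (f 0)); rewrite -fD !addr0.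
split=> // u; apply: (addrI (f u)).
by rewrite -fD !subrr f0.
Qed.

Lemma corestrict_linear (K : pzRingType) (U V : lmodType K)
    (S : submodClosed V) (F : {linear U -> V}) :
  (forall u, F u \in S) ->
  exists G : {linear U -> submod S}, forall u, \val (G u) = F u.
Proof.
move=> SF; pose G u : submod S := Submod (SF u).
have linG : linear G by move=> a u v; apply/val_inj; rewrite /= linearP.
by exists (HB.pack_for {linear U -> submod S} G
  (GRing.isLinear.Build K U (submod S) *:%R G linG)).
Qed.

(** The map on cohomology is [F] applied to a chosen representative; two
representatives differ by a coboundary, where [F] vanishes. *)
Lemma cohomology_lift (K : comPzRingType) (g : lmodType K)
    (C : cochain_complex g) n (W : lmodType K) (F : {linear cocycles C n -> W}) :
  (forall z, z \in @coboundary K g C n -> F z = 0) ->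
  exists G : {linear cohomology C n -> W},
    forall z, G (cohomology_class C n z) = F z.
Proof.
move=> F0; pose G (x : cohomology C n) := F (repr x).
have GE z : G (cohomology_class C n z) = F z.
  apply/eqP; rewrite -subr_eq0 -linearB F0 //.
  by apply/cohomology_class_eq; apply: reprK.
have linG : linear G.
  move=> a x y; have [u <-] := cohomology_class_surj x.
  have [v <-] := cohomology_class_surj y.
  by rewrite -linearP !GE linearP.
by exists (HB.pack_for {linear cohomology C n -> W} G
  (GRing.isLinear.Build K (cohomology C n) W *:%R G linG)).
Qed.

Lemma cohomology_class_eq0 (K : comPzRingType) (g : lmodType K)
    (C : cochain_complex g) n (z : cocycles C n) :
  cohomology_class C n z = 0 <-> z \in @coboundary K g C n.
Proof.
by rewrite -(linear0 (cohomology_class C n)) cohomology_class_eq subr0.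
Qed.

(** * Short tuples and the bracket *)

Lemma tuple1_eta (T : nmodType) (t : 1.-tuple T) : t = [tuple t`_0].
Proof. by apply: eq_from_tnth => i; rewrite ord1 !(tnth_nth 0). Qed.

Lemma tuple2_eta (T : nmodType) (t : 2.-tuple T) : t = [tuple t`_0; t`_1].
Proof.
apply: eq_from_tnth => i; rewrite !(tnth_nth 0).
by case: i => [[|[|//]] ?].
Qed.

Lemma tuple3_eta (T : nmodType) (t : 3.-tuple T) : t = [tuple t`_0; t`_1; t`_2].
Proof.
apply: eq_from_tnth => i; rewrite !(tnth_nth 0).
by case: i => [[|[|[|//]]] ?].
Qed.

Lemma tuple4_eta (T : nmodType) (t : 4.-tuple T) :
  t = [tuple t`_0; t`_1; t`_2; t`_3].
Proof.
apply: eq_from_tnth => i; rewrite !(tnth_nth 0).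
by case: i => [[|[|[|[|//]]]] ?].
Qed.

Section LowDegree.
Variables (K : comPzRingType) (g : lieAlgType K).
Implicit Types (x y z w : g) (phi : g -> g -> K^o).

Lemma bracketC x y : bracket x y = - bracket y x.
Proof.
apply/eqP; rewrite -addr_eq0.
have /linear_zmod[_ _ Dl] := @bracket_linearl K g (x + y).
have /linear_zmod[_ _ Dx] := @bracket_linearr K g x.
have /linear_zmod[_ _ Dy] := @bracket_linearr K g y.
have := bracketxx (x + y).
by rewrite Dl Dx Dy !bracketxx add0r addr0 => ->.
Qed.

(** This holds for every natural number [k]: beyond [n] both sides are the
default value, since [i < n]. *)
Lemma nth_update n (t : n.-tuple g) (i : 'I_n) u k :
  (update t i u)`_k = if k == i then u else t`_k.
Proof.
have [kn|nk] := ltnP k n; last first.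
  rewrite !nth_default ?size_tuple //; case: eqP => // ki.
  by rewrite ki leqNgt ltn_ord in nk.
by rewrite -(tnth_nth 0 _ (Ordinal kn)) tnth_mktuple (tnth_nth 0).
Qed.

(** * The coboundaries in low degree *)

Lemma ce_diff1E (f : cochain g 1) x y :
  ce_diff f [tuple x; y] = - f [tuple bracket x y].
Proof.
rewrite /ce_diff; under eq_bigr do rewrite big_mkcond /=.
rewrite !big_ord_recl !big_ord0 /= !(add0r, addr0) mulN1r.
congr (- f _); apply: eq_from_tnth => i; rewrite tnth_mktuple /=.
by case: i => [[|//] ?].
Qed.

Lemma ce_diff2E (f : cochain g 2) x y z :
  ce_diff f [tuple x; y; z] =
    - f [tuple bracket x y; z] + f [tuple bracket x z; y]
    - f [tuple bracket y z; x].
Proof.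
rewrite /ce_diff; under eq_bigr do rewrite big_mkcond /=.
rewrite !big_ord_recl !big_ord0 /= !(add0r, addr0).
rewrite !exprS expr0 !(mulN1r, mul1r, mulr1, opprK).
congr (- f _ + f _ - f _); apply: eq_from_tnth => i;
  rewrite tnth_mktuple /= !enum_ordSl enum_ord0 /=.
all: by case: i => [[|[|//]] ?].
Qed.

Lemma ce_diff3E (f : cochain g 3) x y z w :
  ce_diff f [tuple x; y; z; w] =
    - f [tuple bracket x y; z; w] + f [tuple bracket x z; y; w]
    - f [tuple bracket x w; y; z] - f [tuple bracket y z; x; w]
    + f [tuple bracket y w; x; z] - f [tuple bracket z w; x; y].
Proof.
rewrite /ce_diff; under eq_bigr do rewrite big_mkcond /=.
rewrite !big_ord_recl !big_ord0 /= !(add0r, addr0).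
rewrite !exprS expr0 !(mulN1r, mul1r, mulr1, opprK) !addrA.
congr (- f _ + f _ - f _ - f _ + f _ - f _); apply: eq_from_tnth => i;
  rewrite tnth_mktuple /= !enum_ordSl enum_ord0 /=.
all: by case: i => [[|[|[|//]]] ?].
Qed.

Lemma loday_diff1E (f : cochain g 1) x y :
  loday_diff f [tuple x; y] = - f [tuple bracket x y].
Proof.
rewrite /loday_diff; under eq_bigr do rewrite big_mkcond /=.
rewrite !big_ord_recl !big_ord0 /= !(add0r, addr0) mulN1r.
congr (- f _); apply: eq_from_tnth => i; rewrite tnth_mktuple /=.
by case: i => [[|//] ?].
Qed.

Lemma loday_diff2E (f : cochain g 2) x y z :
  loday_diff f [tuple x; y; z] =
    - f [tuple bracket x y; z] + f [tuple bracket x z; y]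
    + f [tuple x; bracket y z].
Proof.
rewrite /loday_diff; under eq_bigr do rewrite big_mkcond /=.
rewrite !big_ord_recl !big_ord0 /= !(add0r, addr0).
rewrite !exprS expr0 !(mulN1r, mul1r, mulr1, opprK).
congr (- f _ + f _ + f _); apply: eq_from_tnth => i; rewrite tnth_mktuple /=.
all: by case: i => [[|[|//]] ?].
Qed.

(** * Multilinear and alternating cochains in degrees 1 and 2 *)

Lemma multilinear2P (f : cochain g 2) :
  multilinear f <->
  (forall y, linear (fun x => f [tuple x; y] : K^o)) /\
  (forall x, linear (fun y => f [tuple x; y] : K^o)).
Proof.
have upd0 x y u : update [tuple x; y] ord0 u = [tuple u; y].
  by rewrite [LHS]tuple2_eta !nth_update.
have upd1 x y u : update [tuple x; y] ord_max u = [tuple x; u].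
  by rewrite [LHS]tuple2_eta !nth_update.
split=> [lf|[lf0 lf1] i t a u v].
  split=> [y|x] a u v.
    by have := lf ord0 [tuple 0; y] a u v; rewrite !upd0.
  by have := lf ord_max [tuple x; 0] a u v; rewrite !upd1.
rewrite (tuple2_eta t); have [->|->] : i = ord0 \/ i = ord_max.
- by case: i => [[|[|//]] ?]; [left | right]; apply: val_inj.
- by rewrite !upd0 lf0.
- by rewrite !upd1 lf1.
Qed.

Lemma alternating2P (f : cochain g 2) :
  alternating f <-> forall x, f [tuple x; x] = 0.
Proof.
split=> [af x|af t i j]; first exact: (af [tuple x; x] ord0 ord_max).
rewrite (tuple2_eta t) !(tnth_nth 0).
case: i j => [[|[|//]] ?] [[|[|//]] ?] //= _.
  by move->.
by move=> <-.
Qed.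

(** With a single argument there is no pair of positions to alternate, so the
two complexes have the same 1-cochains. *)
Lemma exterior_cochain1 (f : cochain g 1) :
  (f \in @exterior_cochain K g 1) = (f \in @tensor_cochain K g 1).
Proof.
apply/asboolP/asboolP => [[]|lf] //; split=> // t i j.
by rewrite !ord1.
Qed.

Lemma exterior_tensor n (f : cochain g n) :
  f \in @exterior_cochain K g n -> f \in @tensor_cochain K g n.
Proof. by move=> /asboolP[lf _]; apply/asboolP. Qed.

(** Polarization of [f (x + y, x + y) = 0]. *)
Lemma exterior_cochain2_skew (f : cochain g 2) x y :
  f \in @exterior_cochain K g 2 -> f [tuple x; y] = - f [tuple y; x].
Proof.
move=> /asboolP[/multilinear2P[lf0 lf1] /alternating2P af].
apply/eqP; rewrite -addr_eq0.
have /linear_zmod[_ _ D0] := lf0 (x + y).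
have /linear_zmod[_ _ Dx] := lf1 x.
have /linear_zmod[_ _ Dy] := lf1 y.
by have := af (x + y); rewrite D0 Dx Dy !af add0r addr0 => ->.
Qed.

(** * Comparison of the two coboundaries *)

Lemma loday_ce_diff1 (f : cochain g 1) : loday_diff f = ce_diff f.
Proof.
by apply/funext => t; rewrite (tuple2_eta t) loday_diff1E ce_diff1E.
Qed.

(** The two formulas differ only in the last term, [f (x, [y, z])] against
[- f ([y, z], x)]. *)
Lemma loday_ce_diff2 (f : cochain g 2) :
  f \in @exterior_cochain K g 2 -> loday_diff f = ce_diff f.
Proof.
move=> ef; apply/funext => t; rewrite (tuple3_eta t) loday_diff2E ce_diff2E.
by rewrite (exterior_cochain2_skew t`_0).
Qed.

(** * Symmetric and skew parts, and the Cartan-Koszul cochain *)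

Definition form_cochain phi : cochain g 2 := fun t => phi t`_0 t`_1.

Definition sym_form (f : cochain g 2) : g -> g -> K^o :=
  fun x y => f [tuple x; y] + f [tuple y; x].

Definition skew_part (f : cochain g 2) : cochain g 2 :=
  fun t => f t - f [tuple t`_1; t`_0].

Definition cartan_koszul phi : cochain g 3 :=
  fun t => phi (bracket t`_0 t`_1) t`_2.

Lemma sym_form_linear : linear sym_form.
Proof.
move=> a f f'; apply/funext => x; apply/funext => y.
by rewrite /sym_form !fctE scalerDr addrACA.
Qed.

Lemma cartan_koszul_linear : linear cartan_koszul.
Proof. by move=> a p q; apply/funext. Qed.

Lemma form_cochain_tensor phi :
  phi \in @invariant_form K g -> form_cochain phi \in @tensor_cochain K g 2.
Proof.
by move=> /asboolP[rp lp _ _]; apply/asboolP/multilinear2P.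
Qed.

Lemma skew_part_exterior (f : cochain g 2) :
  f \in @tensor_cochain K g 2 -> skew_part f \in @exterior_cochain K g 2.
Proof.
move=> /asboolP/multilinear2P[lf0 lf1]; apply/asboolP; split.
  apply/multilinear2P; split=> [y|x] a u v; rewrite /skew_part /=.
    by rewrite lf0 lf1 scalerBr opprD addrACA.
  by rewrite lf0 lf1 scalerBr opprD addrACA.
by apply/alternating2P => x; rewrite /skew_part subrr.
Qed.

(** Written without the factor 1/2, the decomposition holds over every ring and
can be carried through the coboundary before 2 is inverted. *)
Lemma sym_skew_decomp (f : cochain g 2) :
  f *+ 2 = form_cochain (sym_form f) + skew_part f.
Proof.
apply/funext => t; rewrite fctE /form_cochain /sym_form /skew_part -tuple2_eta.
by rewrite addrACA subrr addr0.
Qed.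

(** The cocycle equation rewrites a bracket in the second argument of [f] by
brackets in the first one.  Applied to both sides of the invariance equation,
it leaves three terms on each, which agree by antisymmetry of the bracket. *)
Lemma sym_form_invariant (f : cochain g 2) :
  f \in @tensor_cochain K g 2 -> loday_diff f = 0 ->
  sym_form f \in @invariant_form K g.
Proof.
move=> /asboolP/multilinear2P[lf0 lf1] df.
have fN x y : f [tuple - x; y] = - f [tuple x; y].
  by have /linear_zmod[_ ->] := lf0 y.
have cocE x y z : f [tuple x; bracket y z] =
    f [tuple bracket x y; z] - f [tuple bracket x z; y].
  have := congr1 (fun c : cochain g 3 => c [tuple x; y; z]) df.
  rewrite loday_diff2E => /eqP; rewrite addrC addr_eq0 => /eqP->.
  by rewrite opprD opprK.
apply/asboolP; split=> [x a u v|y a u v|x y|x y z]; rewrite /sym_form.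
- by rewrite lf0 lf1 scalerDr addrACA.
- by rewrite lf0 lf1 scalerDr addrACA.
- by rewrite addrC.
- rewrite !cocE (bracketC z x) (bracketC z y) !fN opprK.
  by rewrite addrA.
Qed.

(** Coboundaries are the forms [- f ([x, y])], which are skew; so the
symmetrization descends to cohomology. *)
Lemma sym_form_loday_diff (f : cochain g 1) :
  f \in @tensor_cochain K g 1 -> sym_form (loday_diff f) = 0.
Proof.
move=> /asboolP lf; apply/funext => x; apply/funext => y.
have fN u : f [tuple - u] = - f [tuple u].
  have upd (v : g) : update [tuple 0] ord0 v = [tuple v].
    by rewrite [LHS]tuple1_eta nth_update.
  by have /linear_zmod[_ /(_ u)] := lf ord0 [tuple 0]; rewrite !upd.
by rewrite /sym_form !loday_diff1E (bracketC x) fN opprK subrr.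
Qed.

(** When two arguments coincide, invariance and symmetry bring them together
inside a bracket: [phi ([x, y], y) = phi (x, [y, y])], and
[phi ([x, y], x) = phi (x, [x, y]) = phi ([x, x], y)]. *)
Lemma cartan_koszul_exterior phi :
  phi \in @invariant_form K g ->
  cartan_koszul phi \in @exterior_cochain K g 3.
Proof.
move=> /asboolP[rp lp sp ip].
have p0 x : phi x 0 = 0.
  by have /linear_zmod[] := rp x.
have p0l x : phi 0 x = 0 by rewrite sp p0.
apply/asboolP; split=> [i t a u v|t i j].
  rewrite /cartan_koszul !nth_update; case: i => [[|[|[|//]]] ?] /=.
  - by rewrite bracket_linearl lp.
  - by rewrite bracket_linearr lp.
  - by rewrite rp.
rewrite /cartan_koszul !(tnth_nth 0).
have p010 x y : phi (bracket x y) x = 0.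
  by rewrite sp -ip bracketxx p0l.
have p011 x y : phi (bracket x y) y = 0 by rewrite ip bracketxx p0.
by case: i j => [[|[|[|//]]] ?] [[|[|[|//]]] ?] //= _ ->;
  rewrite ?bracketxx ?p0l ?p010 ?p011.
Qed.

(** The trilinear form [phi ([x, y], z)] is invariant under cyclic permutations
and changes sign under [y <-> z], so each of the three terms of the coboundary
is plus or minus it: they are [- h phi], [- h phi] and [+ h phi]. *)
Lemma loday_diff_form_cochain phi :
  phi \in @invariant_form K g ->
  loday_diff (form_cochain phi) = - cartan_koszul phi.
Proof.
move=> /asboolP[rp lp sp ip].
apply/funext => t; rewrite (tuple3_eta t); move: t`_0 t`_1 t`_2 => x y z.
rewrite loday_diff2E /form_cochain /cartan_koszul /= -ip.
have -> : phi (bracket x z) y = - phi (bracket x y) z.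
  have /linear_zmod[_ pN _] := lp y.
  by rewrite bracketC pN sp -ip sp -ip.
by rewrite addrNK.
Qed.

(** By invariance each of the six terms is, up to sign, [phi (x, -)] of a double
bracket of [y], [z], [w].  With [A], [B], [C] the values at [[y, [z, w]]],
[[z, [y, w]]] and [[w, [y, z]]], the sum is [- 2 A + 2 B - 2 C], and the Jacobi
identity says that [B = A + C]. *)
Lemma ce_diff_cartan_koszul phi :
  phi \in @invariant_form K g -> ce_diff (cartan_koszul phi) = 0.
Proof.
move=> /asboolP[rp lp sp ip].
apply/funext => t; rewrite (tuple4_eta t); move: t`_0 t`_1 t`_2 t`_3 => x y z w.
rewrite ce_diff3E /cartan_koszul /=.
have [_ pN pD] := linear_zmod (rp x).
have e1 a b c :
    phi (bracket (bracket x a) b) c = phi x (bracket a (bracket b c)).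
  by rewrite !ip.
have e2 a b c :
    phi (bracket (bracket a b) x) c = phi x (bracket c (bracket a b)).
  by rewrite ip sp ip.
have jac : phi x (bracket z (bracket y w)) =
    phi x (bracket y (bracket z w)) + phi x (bracket w (bracket y z)).
  have /(congr1 (phi x)) := bracket_jacobi y z w.
  have /linear_zmod[_ bN _] := @bracket_linearr K g z.
  have /linear_zmod[p0 _ _] := rp x.
  rewrite (bracketC w y) bN !pD pN p0 addrAC => /eqP.
  by rewrite subr_eq0 => /eqP.
rewrite !e1 !e2 jac.
set a := phi x _; set b := phi x _.
by rewrite addKr subrr add0r (addrC a) addKr subrr.
Qed.

End LowDegree.

(** * Exactness, on the level of cochains *)

(** If [2 a = phi + w] with [w] alternating and [phi] invariant, then
[2 d a = delta w - h phi].  A primitive [w] of [h phi] thus yields the Leibniz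
cocycle [(phi + w) / 2], and a Leibniz cocycle yields its skew part as a
primitive. *)
Lemma cartan_koszul_exact (K : fieldType) (g : lieAlgType K)
    (phi : g -> g -> K^o) : (2 : K) != 0 ->
  phi \in @invariant_form K g ->
  (exists2 w, w \in @exterior_cochain K g 2 & ce_diff w = cartan_koszul phi) <->
  (exists a : cochain g 2,
     [/\ a \in @tensor_cochain K g 2, loday_diff a = 0 & sym_form a = phi]).
Proof.
move=> two0 inv_phi; split=> [[w ew dw]|[a [ta da <-]]].
  exists (2^-1 *: (form_cochain phi + w)); split.
  - by rewrite rpredZ // rpredD ?form_cochain_tensor ?exterior_tensor.
  - rewrite linearZ linearD /= loday_diff_form_cochain // loday_ce_diff2 //.
    by rewrite dw addNr scaler0.
  - have /asboolP[_ _ sp _] := inv_phi.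
    apply/funext => x; apply/funext => y.
    rewrite /sym_form !fctE /form_cochain /= (sp y) -scalerDr addrACA.
    rewrite (exterior_cochain2_skew x y ew) addNr addr0 -mulr2n -scaler_nat.
    by rewrite scalerA mulVf // scale1r.
exists (skew_part a); first exact: skew_part_exterior.
have := congr1 (@loday_diff K g 2) (sym_skew_decomp a).
rewrite linearMn linearD /= da mul0rn loday_diff_form_cochain; last first.
  exact: sym_form_invariant.
rewrite loday_ce_diff2; last exact: skew_part_exterior.
by move/esym/eqP; rewrite addrC subr_eq0 => /eqP.
Qed.

(** On the diagonal the symmetrization is [2 a (x, x)]. *)
Lemma sym_form_eq0 (K : fieldType) (g : lieAlgType K) (a : cochain g 2) :
  (2 : K) != 0 -> a \in @tensor_cochain K g 2 -> sym_form a = 0 ->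
  a \in @exterior_cochain K g 2.
Proof.
move=> two0 /asboolP la a0; apply/asboolP; split=> //.
apply/alternating2P => x.
have := congr1 (fun p : g -> g -> K^o => p x x) a0.
rewrite /sym_form -mulr2n -mulr_natl => /eqP.
by rewrite mulf_eq0 (negPf two0) => /eqP.
Qed.

(** * The three maps on cohomology *)

Section Maps.
Variables (K : comPzRingType) (g : lieAlgType K).
Let CE := chevalley_eilenberg g.
Let CL := loday g.

Lemma cocycle_ce_loday (a : cocycles CE 2) : \val a \in @cocycle K g CL 2.
Proof.
have /andP[ea da] := valP a.
by rewrite [_ \in _]/= unfold_in exterior_tensor //= loday_ce_diff2.
Qed.

(** Lie coboundaries are Leibniz coboundaries, because the coboundaries agree
on 1-cochains. *)
Lemma inclusion_map : exists f : {linear cohomology CE 2 -> cohomology CL 2},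
  forall a : cocycles CE 2, exists2 b : cocycles CL 2,
    \val b = \val a & f (cohomology_class CE 2 a) = cohomology_class CL 2 b.
Proof.
have [G GE] := corestrict_linear (F := \val) cocycle_ce_loday.
have [z /asboolP[b eb zb]|f fE] :=
  @cohomology_lift _ _ CE 2 _ (cohomology_class CL 2 \o G).
  apply/cohomology_class_eq0/asboolP; exists b.
    by rewrite /= -exterior_cochain1.
  by rewrite GE [LHS]zb /= loday_ce_diff1.
by exists f => a; exists (G a); rewrite ?GE // fE.
Qed.

Lemma symmetrization_map :
  exists s : {linear cohomology CL 2 -> invariant_forms g},
  forall a, \val (s (cohomology_class CL 2 a)) = sym_form (\val a).
Proof.
pose F (a : cocycles CL 2) := sym_form (\val a).
have linF : linear F by move=> c a a'; rewrite /F linearP sym_form_linear.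
pose FL := HB.pack_for {linear cocycles CL 2 -> (g -> g -> K^o)} F
  (GRing.isLinear.Build K (cocycles CL 2) (g -> g -> K^o) *:%R F linF).
have [a|G GE] := @corestrict_linear K _ _ (@invariant_form K g) FL.
  by have /andP[ta /eqP da] := valP a; apply: sym_form_invariant.
have [z /asboolP[b tb zb]|s sE] := @cohomology_lift _ _ CL 2 _ G.
  by apply/val_inj; rewrite GE /= /F zb sym_form_loday_diff.
by exists s => a; rewrite sE GE.
Qed.

Lemma cartan_koszul_map :
  exists h : {linear invariant_forms g -> cohomology CE 3},
  forall p, exists2 c : cocycles CE 3, \val c = cartan_koszul (\val p)
    & h p = cohomology_class CE 3 c.
Proof.
pose F (p : invariant_forms g) := cartan_koszul (\val p).
have linF : linear F by move=> c a a'; rewrite /F linearP cartan_koszul_linear.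
pose FL := HB.pack_for {linear invariant_forms g -> cochain g 3} F
  (GRing.isLinear.Build K (invariant_forms g) (cochain g 3) *:%R F linF).
have [p|G GE] := @corestrict_linear K _ _ (@cocycle K g CE 3) FL.
  apply/andP; split; first exact/cartan_koszul_exterior/valP.
  by apply/eqP/ce_diff_cartan_koszul/valP.
by exists (cohomology_class CE 3 \o G) => p; exists (G p); rewrite ?GE.
Qed.

End Maps.

(** * The exact sequence *)

Theorem proposition3p2 (K : closedFieldType) (char0 : [pchar K] =i pred0)
    (g : lieAlgType K) :
  let CE := chevalley_eilenberg g in
  let CL := loday g in
  exists (f : {linear cohomology CE 2 -> cohomology CL 2})
         (s : {linear cohomology CL 2 -> invariant_forms g})
         (h : {linear invariant_forms g -> cohomology CE 3}),
    [/\ forall a : cocycles CE 2, exists2 b : cocycles CL 2,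
          \val b = \val a
          & f (cohomology_class CE 2 a) = cohomology_class CL 2 b,
        forall (a : cocycles CL 2) (x y : g),
          \val (s (cohomology_class CL 2 a)) x y =
            \val a [tuple x; y] + \val a [tuple y; x]
      & forall p : invariant_forms g, exists2 c : cocycles CE 3,
          (forall x y z : g,
             \val c [tuple x; y; z] = \val p (bracket x y) z)
          & h p = cohomology_class CE 3 c] /\
    [/\ injective f, exact_at f s & exact_at s h].
Proof.
move=> CE CL.
(* 2 is a prime number, hence not in the empty characteristic set. *)
have two0 : (2 : K) != 0 by have := char0 2; rewrite inE /= => /negbT.
have [f fE] := inclusion_map g.
have [s sE] := symmetrization_map g.
have [h hE] := cartan_koszul_map g.
exists f, s, h; split; [split=> [||p] | split].
- exact: fE.
- by move=> a x y; rewrite sE.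
- by have [c cE hp] := hE p; exists c => // x y z; rewrite cE.
(* Injectivity: a Leibniz primitive of a Lie cocycle is also a Lie primitive. *)
- apply: raddf_inj => u; have [a <-] := cohomology_class_surj u.
  have [b ba fab] := fE a.
  move=> /(etrans (esym fab)) /cohomology_class_eq0/asboolP[c tc bc].
  apply/cohomology_class_eq0/asboolP; exists c.
    by rewrite /= exterior_cochain1.
  by rewrite -ba bc /= loday_ce_diff1.
(* Exactness at HL^2: zero symmetrization means alternating. *)
- move=> v; have [b <-] := cohomology_class_surj v; split=> [sb|[u <-]].
    have /andP[tb db] := valP b.
    have eb : \val b \in @exterior_cochain K g 2.
      by apply: sym_form_eq0 => //; rewrite -sE sb.
    have ab : \val b \in @cocycle K g CE 2.
      by apply/andP; split=> //; rewrite /= -loday_ce_diff2.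
    exists (cohomology_class CE 2 (Submod ab)).
    have [b' b'b ->] := fE (Submod ab).
    by congr (cohomology_class _ _ _); apply/val_inj.
  have [a <-] := cohomology_class_surj u; have [b' b'a ->] := fE a.
  have /andP[ea _] := valP a.
  apply/val_inj; rewrite sE b'a; apply/funext => x; apply/funext => y.
  by rewrite /sym_form (exterior_cochain2_skew x y ea) addNr.
- move=> p; have [c cE ->] := hE p.
  have exP := cartan_koszul_exact two0 (valP p).
  split=> [/cohomology_class_eq0/asboolP[w ew cw]|[v sv]].
    have [|a [ta da ap]] := exP.1; first by exists w; rewrite // -cE cw.
    have ca : a \in @cocycle K g CL 2 by apply/andP; split=> //; apply/eqP.
    by exists (cohomology_class CL 2 (Submod ca)); apply/val_inj; rewrite sE.
  apply/cohomology_class_eq0/asboolP.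
  have [b bv] := cohomology_class_surj v; have /andP[tb /eqP db] := valP b.
  have [|w ew dw] := exP.2; first by exists (\val b); rewrite -sv -bv sE.
  by exists w; rewrite // cE -dw.
Qed.
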